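(* Let $A$ be a $C^*$-algebra, and let $N$ denote the not necessarily closed linear subspace of $A$ generated by the square-zero elements of $A$, that is, the linear span of $\{x \in A : x^2 = 0\}$. Then $[N,N] = N$.
   Context: $C^*$-algebras are not assumed to be unital. For subsets $X, Y$ of a $C^*$-algebra, $[X,Y]$ denotes the linear span (no closure) of the set of commutators $[x,y] := xy - yx$ with $x \in X$, $y \in Y$. *)

(* Defs.v *)
From HB Require Import structures.
From mathcomp Require Import all_boot all_order all_algebra.
From mathcomp Require Import complex.
From mathcomp Require Import boolp classical_sets reals topology normedtype.

Set Implicit Arguments.
Unset Strict Implicit.
Unset Printing Implicit Defensive.

Import Order.TTheory GRing.Theory Num.Theory.
Import numFieldNormedType.Exports.

Local Open Scope classical_set_scope.
Local Open Scope ring_scope.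

(* The product is a separate operation, not that of a ring structure, because
   MathComp's rings all have a unit. The norm takes its values in [R[i]], where
   [<=] only holds between elements with the same imaginary part and a norm is
   always a nonnegative real. *)
HB.mixin Record CompleteNormedModule_isCStarAlgebra (R : realType) A
    & CompleteNormedModule R[i] A := {
  cmul : A -> A -> A;
  cstar : A -> A;
  cmulA : associative cmul;
  cmulDl : left_distributive cmul +%R;
  cmulDr : right_distributive cmul +%R;
  cscalerAl : forall (a : R[i]) (x y : A), a *: cmul x y = cmul (a *: x) y;
  cscalerAr : forall (a : R[i]) (x y : A), a *: cmul x y = cmul x (a *: y);
  cstarK : involutive cstar;
  cstarD : {morph cstar : x y / x + y};
  cstarZ : forall (a : R[i]) (x : A), cstar (a *: x) = Num.conj a *: cstar x;
  cstarM : forall x y : A, cstar (cmul x y) = cmul (cstar y) (cstar x);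
  normcM_le : forall x y : A, `|cmul x y| <= `|x| * `|y|;
  normc_cstar : forall x : A, `|cmul (cstar x) x| = `|x| ^+ 2
}.

#[short(type="cstarAlgType")]
HB.structure Definition CStarAlgebra (R : realType) :=
  {A of CompleteNormedModule R[i] A & CompleteNormedModule_isCStarAlgebra R A}.

Definition linear_span (K : nzRingType) (V : lmodType K) (X : set V) : set V :=
  [set v | exists (n : nat) (c : 'I_n -> K) (x : 'I_n -> V),
     (forall i, X (x i)) /\ v = \sum_(i < n) c i *: x i].

Definition commutator (R : realType) (A : cstarAlgType R) (x y : A) : A :=
  cmul x y - cmul y x.

Definition commutator_span (R : realType) (A : cstarAlgType R) (X Y : set A) :
    set A :=
  linear_span [set commutator x y | x in X & y in Y].

Definition square_zero (R : realType) (A : cstarAlgType R) : set A :=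
  [set x : A | cmul x x = 0].
Arguments square_zero {R} A.

(* Main.v *)
(** If [x] and [y] square to zero, then so do [(1 + x) y (1 - x)] and
    [(1 - x) y (1 + x)], whose difference is [2 [x, y]]; hence [[N, N]] is
    contained in [N]. Conversely, if [y] and [z] square to zero then [[y, z]] is
    in [N] and [[[y, z], y] = 2 y z y], so it suffices to write every
    square-zero [x] in the form [y z y]. With the polar decomposition
    [x = v |x|], take [y = v |x|^(1/4)] and [z = |x|^(1/2) v^*].

    The functional calculus this needs is built in the unitization, where
    elements act on [A] by left multiplication and contractions are those of
    operator norm at most [1]. If [T] is self-adjoint and a contraction,
    Visser's iteration [z <- (T + z^2) / 2] from [0] converges to a self-adjoint
    contraction with [(1 - z)^2 = 1 - T]. Applied to [T = a^2] it gives the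
    unitary [a + i (1 - z)], so that [1 - a^2] is a contraction; applied to
    [T = 1 - h] it gives a square root of [h]. Finally, if [u^* u = r^4] then
    [u r^-1] exists as the limit of [u Q_n], where [Q_n] is a Cesaro mean of the
    partial sums of the geometric series of [1 - r]. *)

Require Import Defs.
From HB Require Import structures.
From mathcomp Require Import all_boot all_order all_algebra.
From mathcomp Require Import complex.
From mathcomp Require Import boolp classical_sets reals topology normedtype.
From mathcomp Require Import ring lra.

Set Implicit Arguments.
Unset Strict Implicit.
Unset Printing Implicit Defensive.

Import Order.TTheory GRing.Theory Num.Theory.
Import numFieldNormedType.Exports.

Local Open Scope classical_set_scope.
Local Open Scope ring_scope.

(** * Real bounds and real-valued norms *)

Lemma le0_harmonic (R : realType) (a C : R) :
  (forall n : nat, a <= C / n.+1%:R) -> a <= 0.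
Proof.
move=> aC; rewrite leNgt; apply/negP => a0.
have C0 : 0 <= C / a.
  have := le_trans (ltW a0) (aC 0%N); rewrite divr1 => C0.
  by rewrite divr_ge0// ltW.
have := aC (Num.bound (C / a)); rewrite leNgt => /negP; apply.
rewrite ltr_pdivrMr// mulrC -ltr_pdivrMr//.
by rewrite (lt_trans (archi_boundP C0))// ltr_nat.
Qed.

Section RealNorm.
Variables (R : realType) (V : normedZmodType R[i]).
Implicit Types x y : V.

(** The norm lives in [R[i]], where it is a nonnegative real; its copy in [R] is totally ordered and
    open to [lra] and [nra]. *)
Definition nrm x : R := complex.Re `|x|.

Lemma nrmE x : `|x| = (nrm x)%:C%C.
Proof. by rewrite /nrm RRe_real ?normr_real. Qed.

Lemma nrm_ge0 x : 0 <= nrm x.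
Proof. rewrite -lecR -nrmE; exact: normr_ge0. Qed.

Lemma nrmD x y : nrm (x + y) <= nrm x + nrm y.
Proof. by rewrite -lecR rmorphD /= -!nrmE ler_normD. Qed.

Lemma nrmN x : nrm (- x) = nrm x.
Proof. by rewrite /nrm normrN. Qed.

Lemma nrmBC x y : nrm (x - y) = nrm (y - x).
Proof. by rewrite -nrmN opprB. Qed.

Lemma nrm0 : nrm (0 : V) = 0.
Proof. by rewrite /nrm normr0. Qed.

Lemma nrm0_eq0 x : nrm x = 0 -> x = 0.
Proof. by move=> x0; apply/eqP; rewrite -normr_eq0 nrmE x0. Qed.

End RealNorm.

(** * The unitization as an algebra *)

Section Unitization.
Variables (R : realType) (A : cstarAlgType R).

(** Adjoining a unit embeds [A] as an ideal of an actual ring, so that identities in [A] can be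
    proved there and pulled back along the injective [emb]. *)
Definition unitization : Type := (R[i]^o * A)%type.
HB.instance Definition _ := GRing.Lmodule.on unitization.

Lemma cmul0l (x : A) : cmul 0 x = 0.
Proof. by apply: (@addrI _ (cmul 0 x)); rewrite -cmulDl !addr0. Qed.
Lemma cmul0r (x : A) : cmul x 0 = 0.
Proof. by apply: (@addrI _ (cmul x 0)); rewrite -cmulDr !addr0. Qed.

Definition umul (z w : unitization) : unitization :=
  (z.1 * w.1, z.1 *: w.2 + w.1 *: z.2 + cmul z.2 w.2).
Definition uone : unitization := (1, 0).

Lemma umulA : associative umul.
Proof.
move=> [a x] [b y] [c z]; congr pair; rewrite /= ?mulrA//.
rewrite !scalerDr !cmulDl !cmulDr -!cscalerAl -!cscalerAr !scalerA cmulA.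
by rewrite !addrA [c * a]mulrC [c * b]mulrC [LHS](ACl (1*2*4*6*3*5*7)%AC).
Qed.
Lemma umul1l : left_id uone umul.
Proof.
by move=> [a x]; rewrite /umul /= mul1r scale1r scaler0 cmul0l !addr0.
Qed.
Lemma umul1r : right_id uone umul.
Proof.
by move=> [a x]; rewrite /umul /= mulr1 scale1r scaler0 cmul0r addr0 add0r.
Qed.
Lemma umulDl : left_distributive umul +%R.
Proof.
move=> [a x] [b y] [c z]; congr pair; rewrite /= ?mulrDl//.
by rewrite !scalerDl scalerDr cmulDl !addrA [LHS](ACl (1*3*5*2*4*6)%AC).
Qed.
Lemma umulDr : right_distributive umul +%R.
Proof.
move=> [a x] [b y] [c z]; congr pair; rewrite /= ?mulrDr//.
by rewrite !scalerDl scalerDr cmulDr !addrA [LHS](ACl (1*3*5*2*4*6)%AC).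
Qed.
Lemma uone_neq0 : uone != 0.
Proof. by apply/eqP => -[/eqP]; rewrite oner_eq0. Qed.

HB.instance Definition _ := GRing.Zmodule_isNzRing.Build unitization
  umulA umul1l umul1r umulDl umulDr uone_neq0.

Lemma uscalerAl (a : R[i]) (z w : unitization) : a *: (z * w) = a *: z * w.
Proof.
congr pair; first exact: mulrA.
by rewrite /= !scalerDr !scalerA cscalerAl [a * w.1]mulrC.
Qed.
HB.instance Definition _ :=
  GRing.Lmodule_isLalgebra.Build _ unitization uscalerAl.
Lemma uscalerAr (a : R[i]) (z w : unitization) : a *: (z * w) = z * (a *: w).
Proof.
congr pair; first exact: mulrCA.
by rewrite /= !scalerDr !scalerA cscalerAr [a * z.1]mulrC.
Qed.
HB.instance Definition _ :=
  GRing.Lalgebra_isAlgebra.Build _ unitization uscalerAr.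

Definition emb (x : A) : unitization := (0, x).
End Unitization.

(** * The C*-norm and completeness *)

Section CStarNorm.
Variables (R : realType) (A : cstarAlgType R).
Implicit Types x y : A.

Lemma nrmZ (a : R[i]) x : nrm (a *: x) = nrm a * nrm x.
Proof. by apply/(@complexI R); rewrite rmorphM /= -!nrmE normrZ. Qed.

Lemma nrm_cmul x y : nrm (cmul x y) <= nrm x * nrm y.
Proof. by rewrite -lecR rmorphM /= -!nrmE normcM_le. Qed.

Lemma nrm_cstar_cmul x : nrm (cmul (cstar x) x) = nrm x ^+ 2.
Proof. by apply/(@complexI R); rewrite rmorphXn /= -!nrmE normc_cstar. Qed.

(** The C*-identity gives |x|^2 = |x^* x| <= |x^*| |x|, and |x| cancels. *)
Lemma nrm_cstar_le x : nrm x <= nrm (cstar x).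
Proof.
have [->|x0] := eqVneq (nrm x) 0; first exact: nrm_ge0.
have x1 : 0 < nrm x by rewrite lt_def x0 nrm_ge0.
by rewrite -(ler_pM2r x1) -expr2 -nrm_cstar_cmul nrm_cmul.
Qed.

Lemma nrm_cstar x : nrm (cstar x) = nrm x.
Proof.
by apply/eqP; rewrite eq_le nrm_cstar_le -{2}[x]cstarK nrm_cstar_le.
Qed.

(** Letting m tend to infinity keeps the constant C, so the limit inherits the explicit rate. *)
Lemma cauchy_harmonic (s : nat -> A) (C : R) :
  (forall n m : nat, (n <= m)%N -> nrm (s m - s n) <= C / n.+1%:R) ->
  exists l : A, forall n : nat, nrm (s n - l) <= C / n.+1%:R.
Proof.
move=> sC.
have C0 : 0 <= C by have := sC 0%N 0%N (leqnn _); rewrite subrr nrm0 divr1.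
have /cauchy_cvgP/cvg_ex[l sl] : cauchy (s @ \oo).
  apply/cauchy_exP => e e0.
  have er : e = (complex.Re e)%:C%C by rewrite RRe_real// gtr0_real.
  have r0 : 0 < complex.Re e by rewrite -ltcR -er.
  set r := complex.Re e in er r0.
  pose N := Num.bound (C / r).
  have CN : C / N.+1%:R < r.
    rewrite ltr_pdivrMr// mulrC -ltr_pdivrMr//.
    by rewrite (lt_trans (archi_boundP _)) ?ltr_nat// divr_ge0// ltW.
  exists (s N); exists N => //= n Nn; rewrite /= -ball_normE /= er nrmE ltcR.
  by rewrite nrmBC (le_lt_trans (sC _ _ Nn)).
exists l => n; rewrite -lecR -nrmE; apply/ler_addgt0Pr => e e0.
have /cvgrPdist_le/(_ _ e0)[N _ sN] := sl.
rewrite -(subrKA (s (maxn n N))) (le_trans (ler_normD _ _))// lerD//.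
  by rewrite distrC nrmE lecR sC ?leq_maxl.
by rewrite distrC sN//= leq_maxr.
Qed.
End CStarNorm.

(** * Involution, norms and limits on the unitization *)

Section UnitizationNorm.
Variables (R : realType) (A : cstarAlgType R).
Local Notation E := (unitization A).
Implicit Types (x y a b : A) (z w : E).

Lemma emb_inj : injective (@emb R A).
Proof. by move=> x y []. Qed.
Lemma embD x y : emb (x + y) = emb x + emb y.
Proof. by congr pair; rewrite /= addr0. Qed.
Lemma embN x : emb (- x) = - emb x.
Proof. by congr pair; rewrite /= oppr0. Qed.
Lemma embB x y : emb (x - y) = emb x - emb y.
Proof. by rewrite embD embN. Qed.
Lemma embZ (c : R[i]) x : emb (c *: x) = c *: emb x.
Proof. by congr pair; rewrite /= scaler0. Qed.
Lemma embM x y : emb (cmul x y) = emb x * emb y.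
Proof. by congr pair; rewrite /= ?mulr0// !scale0r !add0r. Qed.

Lemma emb_snd z : z.1 = 0 -> emb z.2 = z.
Proof. by case: z => c x /= ->. Qed.

Lemma emb_scalarE z : z = emb z.2 + (z.1 : R[i]) *: 1.
Proof.
case: z => c x; congr pair; rewrite /= ?scaler0 ?addr0// add0r.
by rewrite [RHS]mulr1.
Qed.

Lemma fstM z w : (z * w).1 = z.1 * w.1. Proof. by []. Qed.

Definition ustar z : E := (Num.conj (z.1 : R[i]), cstar z.2).

Lemma cstar0 : cstar (0 : A) = 0.
Proof. by apply: (@addrI _ (cstar 0)); rewrite -cstarD !addr0. Qed.
Lemma ustarK : involutive ustar.
Proof. by case=> c x; rewrite /ustar /= conjCK cstarK. Qed.
Lemma ustarD z w : ustar (z + w) = ustar z + ustar w.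
Proof. by congr pair; rewrite /= ?cstarD// rmorphD. Qed.
Lemma ustarZ (c : R[i]) z : ustar (c *: z) = Num.conj c *: ustar z.
Proof. by congr pair; rewrite /= ?cstarZ// rmorphM. Qed.
Lemma ustarN z : ustar (- z) = - ustar z.
Proof. by rewrite -scaleN1r ustarZ rmorphN1 scaleN1r. Qed.
Lemma ustarB z w : ustar (z - w) = ustar z - ustar w.
Proof. by rewrite ustarD ustarN. Qed.
Lemma ustarM z w : ustar (z * w) = ustar w * ustar z.
Proof.
congr pair; rewrite /= 1?rmorphM 1?mulrC//.
by rewrite !cstarD !cstarZ cstarM [X in X + _]addrC.
Qed.
Lemma ustar0 : ustar 0 = 0.
Proof. by congr pair; rewrite /= ?cstar0// rmorph0. Qed.
Lemma ustar1 : ustar 1 = 1.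
Proof. by congr pair; rewrite /= ?cstar0// rmorph1. Qed.
Lemma ustar_emb x : ustar (emb x) = emb (cstar x).
Proof. by congr pair; rewrite /= rmorph0. Qed.

(** The sum norm is submultiplicative but in general not a C*-norm. It serves for limits and crude
    bounds; contractions are measured by [opbound]. *)
Definition unorm z : R := nrm (z.1 : R[i]) + nrm z.2.

Lemma unorm_ge0 z : 0 <= unorm z.
Proof. by rewrite addr_ge0 ?nrm_ge0. Qed.
Lemma unorm_emb x : unorm (emb x) = nrm x.
Proof. by rewrite /unorm nrm0 add0r. Qed.
Lemma unormD z w : unorm (z + w) <= unorm z + unorm w.
Proof. by rewrite /unorm addrACA lerD ?nrmD. Qed.
Lemma unormN z : unorm (- z) = unorm z.
Proof. by rewrite /unorm !nrmN. Qed.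
Lemma unorm0_eq0 z : unorm z = 0 -> z = 0.
Proof.
move/eqP; rewrite paddr_eq0 ?nrm_ge0//.
move=> /andP[/eqP/nrm0_eq0 z1 /eqP/nrm0_eq0 z2].
by rewrite [z]surjective_pairing z1 z2.
Qed.
Lemma unormM z w : unorm (z * w) <= unorm z * unorm w.
Proof.
have nC (c d : R[i]) : nrm (c * d) = nrm c * nrm d.
  by apply/(@complexI R); rewrite rmorphM /= -!nrmE normrM.
rewrite /unorm fstM nC mulrDl !mulrDr -!addrA lerD2l.
apply: (le_trans (nrmD _ _)); rewrite addrA lerD ?nrm_cmul//.
by apply: (le_trans (nrmD _ _)); rewrite !nrmZ [nrm w.1 * _]mulrC.
Qed.
Lemma unormZ (c : R[i]) z : unorm (c *: z) = nrm c * unorm z.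
Proof.
rewrite /unorm mulrDr -nrmZ; congr (_ + _).
by apply/(@complexI R); rewrite rmorphM /= -!nrmE normrM.
Qed.
Lemma unorm_star z : unorm (ustar z) = unorm z.
Proof. by rewrite /unorm /= nrm_cstar /nrm norm_conjC. Qed.

Definition uact z b : A := z.1 *: b + cmul z.2 b.

Lemma emb_uact z b : emb (uact z b) = z * emb b.
Proof. by congr pair; rewrite /= ?mulr0// scale0r addr0. Qed.

(** A predicate avoids taking a supremum, which would only be a seminorm: if [A] has a unit e, then
    1 - e acts as 0. *)
Definition opbound (M : R) z := forall b, nrm (uact z b) <= M * nrm b.

Lemma uactD z w b : uact (z + w) b = uact z b + uact w b.
Proof. by apply: emb_inj; rewrite embD !emb_uact mulrDl. Qed.
Lemma uactM z w b : uact (z * w) b = uact z (uact w b).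
Proof. by apply: emb_inj; rewrite !emb_uact mulrA. Qed.
Lemma uactZ (c : R[i]) z b : uact (c *: z) b = c *: uact z b.
Proof. by apply: emb_inj; rewrite embZ !emb_uact scalerAl. Qed.

Lemma opboundD M N z w : opbound M z -> opbound N w -> opbound (M + N) (z + w).
Proof.
by move=> zM wN b; rewrite uactD mulrDl (le_trans (nrmD _ _))// lerD.
Qed.
Lemma opboundN M z : opbound M z -> opbound M (- z).
Proof. by move=> zM b; rewrite -scaleN1r uactZ scaleN1r nrmN. Qed.
Lemma opboundB M N z w : opbound M z -> opbound N w -> opbound (M + N) (z - w).
Proof. by move=> zM wN; apply/opboundD/opboundN. Qed.
Lemma opboundM M N z w : 0 <= M ->
  opbound M z -> opbound N w -> opbound (M * N) (z * w).
Proof.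
move=> M0 zM wN b; rewrite uactM (le_trans (zM _))// -mulrA ler_wpM2l//.
Qed.
Lemma opboundZ (c : R[i]) M z : opbound M z -> opbound (nrm c * M) (c *: z).
Proof.
by move=> zM b; rewrite uactZ nrmZ -mulrA ler_wpM2l ?nrm_ge0.
Qed.
Lemma opbound1 : opbound 1 1.
Proof. by move=> b; rewrite mul1r /uact scale1r cmul0l addr0. Qed.
Lemma opboundX M z n : 0 <= M -> opbound M z -> opbound (M ^+ n) (z ^+ n).
Proof.
move=> M0 zM; elim: n => [|n IHn]; first exact: opbound1.
by rewrite !exprS; apply: opboundM.
Qed.
Lemma opbound_le M N z : M <= N -> opbound M z -> opbound N z.
Proof. by move=> MN zM b; rewrite (le_trans (zM b))// ler_wpM2r ?nrm_ge0. Qed.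
Lemma opbound_unorm z : opbound (unorm z) z.
Proof.
move=> b; rewrite (le_trans (nrmD _ _))// nrmZ mulrDl lerD2l nrm_cmul//.
Qed.
(** Testing on b = x^* gives |x|^2 = |x x^*| <= M |x|. *)
Lemma opbound_emb M x : 0 <= M -> opbound M (emb x) -> nrm x <= M.
Proof.
move=> M0 /(_ (cstar x)); rewrite /uact scale0r add0r nrm_cstar.
rewrite -{1}[x]cstarK nrm_cstar_cmul nrm_cstar.
have [->//|x0] := eqVneq (nrm x) 0.
by rewrite expr2 ler_pM2r// lt_def x0 nrm_ge0.
Qed.

(* Limits are taken at the rate [1/n], so that the limit laws only involve
   explicit constants. *)
Definition hconv (s : nat -> E) z :=
  exists C : R, forall n : nat, unorm (s n - z) <= C / n.+1%:R.

Lemma hconv_uniq s z w : hconv s z -> hconv s w -> z = w.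
Proof.
move=> [C zC] [D wD]; apply/eqP; rewrite -subr_eq0; apply/eqP/unorm0_eq0/eqP.
rewrite eq_le unorm_ge0 andbT; apply: (@le0_harmonic _ _ (C + D)) => n.
rewrite -(subrKA (s n)) (le_trans (unormD _ _))// mulrDl lerD//.
by rewrite -unormN opprB.
Qed.

Lemma hconv_cst z : hconv (fun=> z) z.
Proof. by exists 0 => n; rewrite subrr mul0r /unorm !nrm0 addr0. Qed.

Lemma hconvD s t z w :
  hconv s z -> hconv t w -> hconv (fun n => s n + t n) (z + w).
Proof.
move=> [C zC] [D wD]; exists (C + D) => n.
by rewrite opprD addrACA (le_trans (unormD _ _))// mulrDl lerD.
Qed.

Lemma hconvN s z : hconv s z -> hconv (fun n => - s n) (- z).
Proof. by move=> [C zC]; exists C => n; rewrite -opprD unormN. Qed.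

Lemma hconvB s t z w :
  hconv s z -> hconv t w -> hconv (fun n => s n - t n) (z - w).
Proof. by move=> sz tw; apply/hconvD/hconvN. Qed.

Lemma hconvZ (c : R[i]) s z : hconv s z -> hconv (fun n => c *: s n) (c *: z).
Proof.
move=> [C zC]; exists (nrm c * C) => n.
by rewrite -scalerBr unormZ -mulrA ler_wpM2l ?nrm_ge0.
Qed.

Lemma hconv_star s z : hconv s z -> hconv (fun n => ustar (s n)) (ustar z).
Proof. by move=> [C zC]; exists C => n; rewrite -ustarB unorm_star. Qed.

Lemma hconvS s z : hconv s z -> hconv (fun n => s n.+1) z.
Proof.
move=> [C zC]; exists C => n; rewrite (le_trans (zC _))// ler_wpM2l//.
  by have := le_trans (unorm_ge0 _) (zC 0%N); rewrite divr1.
by rewrite lef_pV2 ?posrE// ler_nat.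
Qed.

Lemma hconvM s t z w :
  hconv s z -> hconv t w -> hconv (fun n => s n * t n) (z * w).
Proof.
(* [D + unorm w] bounds the norm of every [t n], because 1/(n+1) <= 1. *)
move=> [C zC] [D wD]; exists (C * (D + unorm w) + unorm z * D) => n.
have C0 : 0 <= C by have := le_trans (unorm_ge0 _) (zC 0%N); rewrite divr1.
have D0 : 0 <= D by have := le_trans (unorm_ge0 _) (wD 0%N); rewrite divr1.
have -> : s n * t n - z * w = (s n - z) * t n + z * (t n - w).
  by rewrite mulrBl mulrBr addrA subrK.
rewrite (le_trans (unormD _ _))// [leRHS]mulrDl lerD//; last first.
  by rewrite (le_trans (unormM _ _))// -mulrA ler_wpM2l ?unorm_ge0.
rewrite (le_trans (unormM _ _))// mulrAC ler_pM ?unorm_ge0//.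
rewrite -[t n](subrK w) (le_trans (unormD _ _))// lerD2r (le_trans (wD n))//.
by rewrite ler_piMr// invf_le1 ?ler1n.
Qed.

Lemma hconv_opbound M s z :
  (forall n, opbound M (s n)) -> hconv s z -> opbound M z.
Proof.
move=> sM [C zC] b; rewrite -subr_le0.
apply: (@le0_harmonic _ _ (C * nrm b)) => n.
rewrite lerBlDr -{1}[z](subrK (s n)) uactD (le_trans (nrmD _ _))// lerD ?sM//.
rewrite (le_trans (opbound_unorm _ _))// -unormN opprB.
by rewrite mulrAC ler_wpM2r ?nrm_ge0.
Qed.

Lemma hconv_cauchy (s : nat -> A) (C : R) :
  (forall n m : nat, (n <= m)%N -> nrm (s m - s n) <= C / n.+1%:R) ->
  exists x, hconv (fun n => emb (s n)) (emb x).
Proof.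
by move=> /cauchy_harmonic[x sx]; exists x, C => n; rewrite -embB unorm_emb.
Qed.

(** By the C*-identity, |zb|^2 = |b^* z^* z b| = |b^* b| = |b|^2. *)
Lemma nrm_uact_isometry z b : ustar z * z = 1 -> nrm (uact z b) = nrm b.
Proof.
move=> zz; apply/eqP; rewrite -(@eqrXn2 _ 2) ?nrm_ge0// -!nrm_cstar_cmul.
apply/eqP; congr nrm; apply: emb_inj; rewrite !embM -!ustar_emb emb_uact ustarM.
by rewrite mulrA -(mulrA (ustar (emb b))) zz mulr1.
Qed.

End UnitizationNorm.

(** * Contractions from the growth of powers, and the scalar iteration *)

Section Positivity.
Variables (R : realType) (A : cstarAlgType R).
Local Notation E := (unitization A).
Implicit Types (x y a b : A) (z w : E).

Lemma bernoulli (d : R) n : 0 <= d -> 1 + n%:R * d <= (1 + d) ^+ n.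
Proof.
move=> d0; elim: n => [|n IHn]; first by rewrite mul0r addr0 expr0.
rewrite exprS; apply: (@le_trans _ _ ((1 + d) * (1 + n%:R * d))).
  by rewrite -natr1; have := mulr_ge0 (ler0n R n) (sqr_ge0 d); nra.
by rewrite ler_wpM2l// addr_ge0.
Qed.

Lemma nrm_sqr_le z b : ustar z = z ->
  nrm (uact z b) ^+ 2 <= nrm b * nrm (uact (z ^+ 2) b).
Proof.
move=> zz; rewrite -nrm_cstar_cmul.
have -> : cmul (cstar (uact z b)) (uact z b) = cmul (cstar b) (uact (z ^+ 2) b).
  apply: emb_inj; rewrite !embM -!ustar_emb !emb_uact ustarM zz.
  by rewrite expr2 !mulrA.
by rewrite (le_trans (nrm_cmul _ _))// nrm_cstar.
Qed.

Lemma ustarX z n : ustar (z ^+ n) = ustar z ^+ n.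
Proof.
by elim: n => [|n IHn]; rewrite ?expr0 ?ustar1// exprS ustarM IHn exprSr.
Qed.

(** Each induction step squares the bound, applies [nrm_sqr_le] to z^(2^n) and cancels one factor
    |b|. *)
Lemma nrm_exp2_le z b n : ustar z = z ->
  nrm (uact z b) ^+ (2 ^ n) * nrm b <=
  nrm b ^+ (2 ^ n) * nrm (uact (z ^+ (2 ^ n)) b).
Proof.
move=> zz; elim: n => [|n IHn]; first by rewrite expn0 !expr1 mulrC.
have [->|b0] := eqVneq (nrm b) 0.
  by rewrite mulr0 expr0n expn_eq0 /= mul0r.
have b1 : 0 < nrm b by rewrite lt_def b0 nrm_ge0.
rewrite -(ler_pM2r b1) -mulrA -expr2 expnSr exprM -exprMn [leRHS]mulrAC.
set X := _ * _ in IHn *; set Y := nrm (uact (z ^+ _) b) in IHn.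
apply: (@le_trans _ _ ((nrm b ^+ (2 ^ n) * Y) ^+ 2)).
  by rewrite ler_pXn2r ?nnegrE ?mulr_ge0 ?exprn_ge0 ?nrm_ge0.
rewrite exprMn -exprM -mulrA ler_wpM2l ?exprn_ge0 ?nrm_ge0//.
by rewrite exprM nrm_sqr_le// ustarX zz.
Qed.

(* By the C*-identity, the operator norm of a self-adjoint [z] satisfies
   [|z| ^+ (2 ^ n) = |z ^+ (2 ^ n)|]. *)
Lemma opbound1_of_growth z : ustar z = z ->
  (forall n, opbound (1 + n%:R) (z ^+ n)) -> opbound 1 z.
Proof.
move=> zz zn b; rewrite mul1r.
have [b0|b0] := eqVneq (nrm b) 0.
  by have := zn 1%N b; rewrite b0 mulr0 expr1.
have b1 : 0 < nrm b by rewrite lt_def b0 nrm_ge0.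
rewrite leNgt; apply/negP => bz.
(* [d] is the excess of |zb|/|b| over 1; the growth hypothesis forces (1 + d)^(2^n) <= 1 + 2^n. *)
pose d := nrm (uact z b) / nrm b - 1.
have d0 : 0 < d by rewrite subr_gt0 ltr_pdivlMr// mul1r.
have qn n : (1 + d) ^+ (2 ^ n) <= 1 + (2 ^ n)%:R.
  rewrite /d subrKC expr_div_n ler_pdivrMr ?exprn_gt0//.
  rewrite -(ler_pM2r b1) (le_trans (nrm_exp2_le _ _ zz))//.
  by rewrite [leRHS]mulrAC [leLHS]mulrC ler_wpM2r ?exprn_ge0 ?nrm_ge0// ?zn.
clearbody d; suff : d ^+ 2 <= 0 by rewrite leNgt exprn_gt0.
(* With k = 2^n, Bernoulli gives (1 + k d)^2 <= (1 + d)^(2k) <= 1 + 2k, hence k d^2 <= 2, and n + 1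
   <= k. *)
apply: (@le0_harmonic _ _ 2) => n; rewrite ler_pdivlMr//.
set k : R := (2 ^ n)%:R.
have nk : n.+1%:R <= k by rewrite ler_nat ltn_expl.
have k0 : 0 < k by rewrite (lt_le_trans _ nk).
apply: (@le_trans _ _ (d ^+ 2 * k)); first by rewrite ler_wpM2l ?sqr_ge0.
rewrite -(ler_pM2r k0).
have := qn n.+1; rewrite expnSr exprM natrM -/k => le1.
have le2 : (1 + k * d) ^+ 2 <= ((1 + d) ^+ (2 ^ n)) ^+ 2.
  have [d0' k0'] := (ltW d0, ltW k0).
  rewrite ler_pXn2r ?nnegrE ?exprn_ge0 ?addr_ge0 ?mulr_ge0//.
  exact: bernoulli.
have arith (u v : R) : 0 < u * v -> (1 + u * v) ^+ 2 <= 1 + u * 2 ->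
  v ^+ 2 * u * u <= 2 * u by nra.
exact: arith (mulr_gt0 k0 d0) (le_trans le2 le1).
Qed.

Lemma nrm_real (r : R) : nrm (r%:C%C : R[i]) = `|r|.
Proof.
apply/(@complexI R); rewrite -nrmE normc_def /= expr0n addr0.
by rewrite -[in RHS]sqrtr_sqr.
Qed.

(** Visser's iteration for T = 1, which majorizes the iteration for every contraction T. *)
Definition visser_real n : R := iter n (fun t => 2^-1 * (1 + t ^+ 2)) 0.

Lemma visser_realS n : visser_real n.+1 = 2^-1 * (1 + visser_real n ^+ 2).
Proof. by []. Qed.

(** The defect d = 1 - t evolves by d <- d - d^2/2, a map increasing on [0, 1]; so the bound p =
    2/(n+2) passes to p - p^2/2 <= 2/(n+3). *)
Lemma visser_realP n :
  0 <= visser_real n <= 1 /\ 1 - visser_real n <= 2 / n.+2%:R.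
Proof.
elim: n => [|n [/andP[z0 z1] IHn]].
  by rewrite /visser_real /= lexx ler01 subr0 divff ?pnatr_eq0.
rewrite visser_realS.
move: z0 z1 IHn; move: (visser_real n) => t t0 t1 IHn; split.
  have t2 : 0 <= t ^+ 2 <= 1 by rewrite sqr_ge0 expr_le1.
  by move: t2 => /andP[? ?]; apply/andP; split; lra.
have [N0 N1] : 0 < n.+2%:R :> R /\ n.+3%:R = n.+2%:R + 1 :> R by rewrite natr1.
rewrite N1 ler_pdivlMr ?addr_gt0//.
move: IHn; rewrite ler_pdivlMr//; set N : R := n.+2%:R in N0 *.
have N2 : 2 <= N by rewrite ler_nat.
set dl := 1 - t.
have -> : 1 - 2^-1 * (1 + t ^+ 2) = dl - dl ^+ 2 / 2 by rewrite /dl; field.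
have : 0 <= dl <= 1 by rewrite /dl; apply/andP; split; lra.
move: dl => dl /andP[d0 d1] dN.
pose p := 2 / N.
have pN : p * N = 2 by rewrite divfK ?gt_eqF.
have p1 : p <= 1 by rewrite ler_pdivrMr// mul1r.
have dp : dl <= p by rewrite ler_pdivlMr.
have le1 : dl - dl ^+ 2 / 2 <= p - p ^+ 2 / 2.
  by have : 0 <= (p - dl) * (1 - (p + dl) / 2); [apply: mulr_ge0; lra|nra].
apply: (@le_trans _ _ ((p - p ^+ 2 / 2) * (N + 1))).
  by rewrite ler_wpM2r// addr_ge0// ltW.
have -> : (p - p ^+ 2 / 2) * (N + 1) =
  p * N + p - p * (p * N) / 2 - p ^+ 2 / 2 by field.
by rewrite pN; nra.
Qed.
End Positivity.

(** * Square roots by Visser's iteration *)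

Section SquareRoot.
Variables (R : realType) (A : cstarAlgType R).
Local Notation E := (unitization A).
Implicit Types (x y a b : A) (z w : E).

Definition visser (T : E) n : E := iter n (fun z => 2^-1 *: (T + z * z)) 0.

Lemma visserS T n : visser T n.+1 = 2^-1 *: (T + visser T n * visser T n).
Proof. by []. Qed.

Lemma nrm_half : nrm (2^-1 : R[i]) = 2^-1.
Proof.
have -> : (2^-1 : R[i]) = (2^-1 : R)%:C%C by rewrite fmorphV rmorph_nat.
by rewrite nrm_real ger0_norm ?invr_ge0 ?ler0n.
Qed.

(** Both iterations satisfy z_(m+1) - z_(n+1) = (z_m (z_m - z_n) + (z_m - z_n) z_n) / 2, so the
    scalar differences bound those of the operators by induction. *)
Lemma visser_opbound (T : E) n m : opbound 1 T -> (n <= m)%N ->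
  0 <= visser_real R m - visser_real R n /\
  opbound (visser_real R m - visser_real R n) (visser T m - visser T n).
Proof.
move=> T1.
have v0 k : 0 <= visser_real R k by have [/andP[]] := visser_realP R k.
have vb k : opbound (visser_real R k) (visser T k).
  elim: k => [|k IHk].
    by move=> b; rewrite mul0r /uact scale0r cmul0l addr0 nrm0.
  rewrite visserS visser_realS -nrm_half.
  by apply/opboundZ/opboundD => //; rewrite expr2; apply: opboundM.
elim: n m => [|n IHn] [|m]// nm; first by rewrite !subr0.
  by rewrite !subr0.
have {IHn} [ge0 IH] := IHn m nm.
have eqv : visser_real R m.+1 - visser_real R n.+1 = 2^-1 *
    (visser_real R m * (visser_real R m - visser_real R n) +
     (visser_real R m - visser_real R n) * visser_real R n).
  by rewrite !visser_realS; ring.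
rewrite eqv; split.
  by rewrite mulr_ge0 ?invr_ge0 ?ler0n// addr_ge0// mulr_ge0.
have -> : visser T m.+1 - visser T n.+1 = 2^-1 *:
    (visser T m * (visser T m - visser T n) +
     (visser T m - visser T n) * visser T n).
  rewrite !visserS -scalerBr; congr (_ *: _).
  by rewrite mulrBr mulrBl addrA subrK opprD addrACA subrr add0r.
by rewrite -nrm_half; apply/opboundZ/opboundD; apply: opboundM.
Qed.

Lemma hconv_scalar (s : nat -> R) (l C : R) :
  (forall n, `|s n - l| <= C / n.+1%:R) ->
  hconv (fun n => (s n)%:C%C *: (1 : E)) (l%:C%C *: 1).
Proof.
move=> sl; exists (C * unorm (1 : E)) => n.
rewrite -scalerBl -rmorphB unormZ nrm_real mulrAC ler_wpM2r//.
exact: unorm_ge0.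
Qed.

(* [t] is the scalar part of [T]; as [t] is idempotent, the scalar part of the
   [n]-th iterate is [t%:R * visser_real n]. *)
Lemma visser_sqrt (T : E) (t : bool) : T.1 = t%:R -> ustar T = T ->
    opbound 1 T ->
  exists z, [/\ z.1 = t%:R, ustar z = z, opbound 1 z, (1 - z) ^+ 2 = 1 - T
    & forall w, w * T = T * w -> w * z = z * w].
Proof.
move=> Tt TT T1.
pose v := visser_real R; pose zs := visser T.
have vP n : 0 <= v n <= 1 /\ 1 - v n <= 2 / n.+1%:R.
  have [v1 v2] := visser_realP R n; split=> //.
  by rewrite (le_trans v2)// ler_wpM2l// lef_pV2 ?posrE// ler_nat.
have zs1 n : (zs n).1 = (t%:R * v n)%:C%C.
  elim: n => [|n IHn]; first by rewrite /= mulr0.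
  have -> : (zs n.+1).1 = 2^-1 * (T.1 + (zs n).1 * (zs n).1) by [].
  rewrite IHn Tt /v visser_realS -/(v n).
  case: t {Tt IHn}; rewrite ?mul1r ?mul0r ?rmorph0 ?mul0r ?addr0 ?mulr0//.
  by rewrite rmorphM rmorphD rmorphXn fmorphV rmorph_nat rmorph1.
have zsE n : zs n = emb (zs n).2 + (t%:R * v n)%:C%C *: (1 : E).
  by rewrite -zs1 -emb_scalarE.
have t1 : 0 <= (t%:R : R) <= 1 by case: t {Tt zs1 zsE}; rewrite /= ?lexx ?ler01.
(* [opbound] controls the norm only on [A], so the Cauchy estimate is made for the components in
   [A]. Removing the scalar part costs a second [v m - v n], whence 4 = 2 * 2. *)
have [x zx] : exists x, hconv (fun n => emb (zs n).2) (emb x).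
  apply: (@hconv_cauchy _ _ _ 4) => n m nm.
  have [ge0 zb] := visser_opbound T1 nm.
  have [[_ vn] [/andP[_ vm] _]] := (vP n, vP m).
  apply: (@le_trans _ _ (2 * (v m - v n))); last first.
    have -> : 4 / n.+1%:R = 2 * (2 / n.+1%:R) :> R by rewrite mulrA -natrM.
    by rewrite ler_wpM2l// (le_trans _ vn)// lerB.
  apply: opbound_emb; first by rewrite mulr_ge0.
  have -> : emb ((zs m).2 - (zs n).2) =
      zs m - zs n - (t%:R * (v m - v n))%:C%C *: (1 : E).
    rewrite [in RHS](zsE m) [in RHS](zsE n) mulrBr rmorphB scalerBl embB.
    by rewrite opprD addrACA addrK.
  rewrite mulr_natl mulr2n; apply: opboundB => //.
  apply: (@opbound_le _ _ (`|t%:R * (v m - v n)| * 1)).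
    by case/andP: t1 => t0 t1; rewrite mulr1 ger0_norm ?mulr_ge0// ler_piMl.
  by rewrite -nrm_real; apply/opboundZ/opbound1.
pose z := emb x + (t%:R)%:C%C *: (1 : E).
have zz : hconv zs z.
  have -> : zs = fun n => emb (zs n).2 + (t%:R * v n)%:C%C *: (1 : E).
    by apply/funext.
  apply: hconvD => //; apply: (@hconv_scalar _ _ 2) => n.
  have [/andP[v0 v1] v2] := vP n; rewrite -[X in _ - X]mulr1 -mulrBr normrM.
  rewrite ger0_norm; last by case/andP: t1.
  rewrite distrC ger0_norm ?subr_ge0// (le_trans _ v2)//.
  by case/andP: t1 => _ ?; rewrite ler_piMl// subr_ge0.
exists z; split.
- by rewrite /= add0r /GRing.scale /= mulr1 rmorph_nat.
- apply: (hconv_uniq _ zz).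
  have -> : zs = fun n => ustar (zs n); last exact: hconv_star.
  apply/funext; elim=> [|n IHn]; first by rewrite (_ : zs 0%N = 0)// ustar0.
  rewrite /zs visserS -/(zs n) ustarZ ustarD ustarM TT -IHn.
  by rewrite fmorphV rmorph_nat.
- apply: hconv_opbound zz => n; have [/andP[_ v1] _] := vP n.
  apply: (opbound_le v1); have [_] := visser_opbound T1 (leq0n n).
  by rewrite !subr0.
(* The shifted sequence has the same limit, so z is a fixed point, which amounts to (1 - z)^2 = 1 -
   T. *)
- have : 2^-1 *: (T + z * z) = z.
    apply: (hconv_uniq _ (hconvS zz)); apply/hconvZ/hconvD.
      exact: hconv_cst.
    exact: hconvM.
  move=> /(congr1 (fun w => 2 *: w)); rewrite scalerA divff ?pnatr_eq0//.
  rewrite scale1r => Tz.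
  have -> : T = 2 *: z - z * z by rewrite -Tz addrK.
  rewrite expr2 mulrBl mul1r mulrBr mulr1 scaler_nat mulr2n.
  by rewrite !opprD !opprK !addrA.
- move=> w wT; have comm n : w * zs n = zs n * w.
    elim: n => [|n IHn]; first by rewrite mulr0 mul0r.
    rewrite /zs visserS -/(zs n) -scalerAl -scalerAr mulrDl mulrDr wT.
    by rewrite mulrA IHn -mulrA IHn mulrA.
  apply: (hconv_uniq (hconvM (hconv_cst w) zz)).
  have -> : (fun n => w * zs n) = fun n => zs n * w by apply/funext.
  exact: (hconvM zz (hconv_cst w)).
Qed.
End SquareRoot.

(** * Contractions 1 - x^2 and 1 - x^* x, and square roots in the algebra *)

Section Factorization.
Variables (R : realType) (A : cstarAlgType R).
Local Notation E := (unitization A).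
Implicit Types (x y a b : A) (z w : E).

Lemma opbound_cut M z : 0 <= M -> z.1 = 0 -> opbound M z -> unorm z <= M.
Proof.
by move=> M0 z1; rewrite -(emb_snd z1) unorm_emb; exact: opbound_emb.
Qed.

(** For T = x^2, the root w = 1 - z commutes with x and x^2 + w^2 = 1, so U = x + i w is unitary
    with adjoint V = x - i w. Hence w = (U - V) / (2i) is a contraction, and so is w^2 = 1 - x^2. *)
Lemma opbound1_subr_sqr x : cstar x = x -> nrm x <= 1 ->
  opbound 1 (1 - emb x ^+ 2).
Proof.
move=> xx x1.
have T1 : opbound 1 (emb x ^+ 2).
  apply: (@opbound_le _ _ (nrm x ^+ 2)); first by rewrite expr_le1 ?nrm_ge0.
  by apply: opboundX; rewrite ?nrm_ge0// -unorm_emb; apply: opbound_unorm.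
have TT : ustar (emb x ^+ 2) = emb x ^+ 2 by rewrite ustarX ustar_emb xx.
have [|z [_ zz _ zT zC]] := @visser_sqrt _ _ (emb x ^+ 2) false _ TT T1.
  by rewrite expr2 fstM /= mul0r.
have xz : emb x * (1 - z) = (1 - z) * emb x.
  by rewrite mulrBr mulrBl mulr1 mul1r zC// -exprS exprSr.
have zE : emb x ^+ 2 + (1 - z) ^+ 2 = 1 by rewrite zT addrC subrK.
have zS : ustar (1 - z) = 1 - z by rewrite ustarB ustar1 zz.
pose U := emb x + 'i *: (1 - z); pose V := emb x - 'i *: (1 - z).
have UV : ustar U = V.
  by rewrite ustarD ustar_emb xx ustarZ zS conjCi scaleNr.
have ii : - ('i * 'i) = 1 :> R[i] by rewrite -expr2 sqrCi opprK.
have VU1 : V * U = 1.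
  rewrite -zE mulrBl !mulrDr -!scalerAl -!scalerAr scalerA xz -!expr2.
  by rewrite opprD addrA addrK -scaleNr ii scale1r.
have UV1 : U * V = 1.
  rewrite -zE mulrDl !mulrBr -!scalerAl -!scalerAr scalerA xz -!expr2.
  by rewrite addrA subrK -scaleNr ii scale1r.
have U1 : opbound 1 U by move=> b; rewrite mul1r nrm_uact_isometry// UV.
have V1 : opbound 1 V.
  by move=> b; rewrite mul1r nrm_uact_isometry// -UV ustarK UV.
have z1 : opbound 1 (1 - z).
  have i2 : 2 * 'i != 0 :> R[i] by rewrite mulf_neq0 ?pnatr_eq0 ?neq0Ci.
  have -> : 1 - z = (2 * 'i)^-1 *: (U - V).
    apply: (scalerI i2); rewrite scalerA divff// scale1r.
    rewrite /U /V; move: (1 - z) => w.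
    by rewrite opprB addrC addrA subrK -scalerDl mulr_natl mulr2n.
  have -> : 1 = nrm ((2 * 'i)^-1 : R[i]) * (1 + 1) :> R.
    apply/(@complexI R); rewrite rmorphM /= -nrmE normfV normrM normCi mulr1.
    by rewrite normr_nat -mulr2n rmorph_nat mulVf ?pnatr_eq0.
  exact/opboundZ/opboundB.
by rewrite -zT -(expr1n _ 2); exact: opboundX.
Qed.

(* With [k = x + x^*], [h = x^* x] and [D = 1 - k^2], one has
   [D = (1 - h) (1 - x x^* )], hence [h (1 - h)^n = h D^n], so that the powers
   of [1 - h] grow at most linearly. *)
Lemma square_zero_opbound x : cmul x x = 0 -> nrm x <= 2^-1 ->
  opbound 1 (1 - emb (cmul (cstar x) x)).
Proof.
move=> xx x2; rewrite embM -ustar_emb.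
set X := emb x; set Y := ustar X.
have XX : X * X = 0 by rewrite -embM xx.
have YY : Y * Y = 0 by rewrite -ustarM XX ustar0.
pose k := x + cstar x; pose D := 1 - emb k ^+ 2; pose P := 1 - Y * X.
have D1 : opbound 1 D.
  apply: opbound1_subr_sqr; first by rewrite cstarD cstarK addrC.
  rewrite (le_trans (nrmD _ _))// nrm_cstar; lra.
have DE : D = 1 - (X * Y + Y * X).
  rewrite /D /k embD -ustar_emb -/X -/Y expr2 mulrDl !mulrDr XX YY.
  by rewrite add0r addr0.
have hD n : Y * X * P ^+ n = Y * X * D ^+ n.
  have PD : Y * X * P = Y * X * D.
    rewrite DE /P !mulrBr mulrDr !mulrA -[Y * X * X]mulrA XX.
    by rewrite mulr0 mul0r add0r.
  have PC : P * (Y * X) = Y * X * P by rewrite mulrBr mulrBl mulr1 mul1r.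
  elim: n => [|n IHn]; first by rewrite !expr0.
  by rewrite !exprS [LHS]mulrA -PC -[LHS]mulrA IHn [LHS]mulrA PC PD -[LHS]mulrA.
have h1 : opbound 1 (Y * X).
  rewrite -[1]mulr1; apply: opboundM => //.
    apply: (@opbound_le _ _ (unorm Y)); last exact: opbound_unorm.
    by rewrite unorm_star unorm_emb; lra.
  apply: (@opbound_le _ _ (unorm X)); last exact: opbound_unorm.
  by rewrite unorm_emb; lra.
apply: opbound1_of_growth; first by rewrite ustarB ustar1 ustarM ustarK.
elim=> [|n IHn]; first by rewrite addr0 expr0; exact: opbound1.
have -> : (1 - Y * X) ^+ n.+1 = P ^+ n - Y * X * D ^+ n.
  by rewrite -hD exprS mulrBl mul1r.
have : opbound (1 * 1 ^+ n) (Y * X * D ^+ n).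
  by apply: opboundM => //; apply: opboundX.
by rewrite expr1n mulr1 -natr1 addrA; apply: opboundB.
Qed.

(** For T = 1 - x the scalar part of z is 1, so the root 1 - z lies in [A]. Its complement z is
    again a contraction, which allows roots to be iterated. *)
Lemma opbound_sqrt x : cstar x = x -> opbound 1 (1 - emb x) ->
  exists y, [/\ cstar y = y, cmul y y = x & opbound 1 (1 - emb y)].
Proof.
move=> xx x1.
have TT : ustar (1 - emb x) = 1 - emb x by rewrite ustarB ustar1 ustar_emb xx.
have [|z [zt zz zb zT _]] := @visser_sqrt _ _ (1 - emb x) true _ TT x1.
  by rewrite /= oppr0 addr0.
have yE : emb (1 - z).2 = 1 - z by apply: emb_snd; rewrite /= zt subrr.
exists (1 - z).2; split.
- by apply: emb_inj; rewrite -ustar_emb yE ustarB ustar1 zz.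
- by apply: emb_inj; rewrite embM yE -expr2 zT opprB addrC subrK.
- by rewrite yE opprB addrC subrK.
Qed.

Lemma nrm_cstar_cmul_inj x y :
  cmul (cstar x) x = cmul (cstar y) y -> nrm x = nrm y.
Proof.
move=> /(congr1 (@nrm _ _)); rewrite !nrm_cstar_cmul => /eqP.
by rewrite eqrXn2 ?nrm_ge0// => /eqP.
Qed.
End Factorization.

(** * Division by roots of the modulus, and the factorization of square-zero elements *)

Section Division.
Variables (R : realType) (A : cstarAlgType R).
Local Notation E := (unitization A).
Implicit Types (x y u v r : A) (z w : E).

Lemma inv_natC n : nrm ((n.+1%:R)^-1 : R[i]) = n.+1%:R^-1.
Proof.
by apply/(@complexI R); rewrite -nrmE normfV normr_nat fmorphV rmorph_nat.
Qed.

Definition cesaro (T : E) n : E := n.+1%:R^-1 *: \sum_(i < n.+1) T ^+ i.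

(** The mean of the partial sums 0, 1, 1 + T, ... of the geometric series, as an approximate inverse
    of 1 - T. *)
Definition cesaro2 (T : E) n : E :=
  n.+1%:R^-1 *: \sum_(j < n.+1) \sum_(i < j) T ^+ i.

Lemma cesaro2P (T : E) n : (1 - T) * cesaro2 T n = 1 - cesaro T n.
Proof.
rewrite -scalerAr mulr_sumr.
under eq_bigr => j _.
  rewrite -[1 - T]opprB mulNr -subrX1 opprB; over.
rewrite sumrB sumr_const card_ord scalerBr; congr (_ - _).
have -> : (1 : E) *+ n.+1 = (n.+1%:R : R[i]) *: 1 by rewrite scaler_nat.
by rewrite scalerA mulVf ?scale1r// pnatr_eq0.
Qed.

(** The product telescopes to (1 - T^(n+1)) / (n+1). *)
Lemma cesaro_opbound (T : E) n : opbound 1 T ->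
  opbound (2 / n.+1%:R) ((1 - T) * cesaro T n).
Proof.
move=> T1; rewrite -scalerAr -[1 - T]opprB mulNr -subrX1 opprB mulrC -inv_natC.
apply/opboundZ; have := opboundX n.+1 ler01 T1; rewrite expr1n.
by move=> /(opboundB (@opbound1 R A)); rewrite -mulr2n.
Qed.

Lemma ustar_sum I (s : seq I) (F : I -> E) :
  ustar (\sum_(i <- s) F i) = \sum_(i <- s) ustar (F i).
Proof. by elim/big_rec2: _ => [|i z w _ <-]; rewrite ?ustar0 ?ustarD. Qed.

Lemma ustar_inv_nat n z : ustar (n.+1%:R^-1 *: z) = n.+1%:R^-1 *: ustar z.
Proof. by rewrite ustarZ fmorphV rmorph_nat. Qed.

Lemma ustar_cesaro (T : E) n : ustar T = T -> ustar (cesaro T n) = cesaro T n.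
Proof.
move=> TT; rewrite ustar_inv_nat ustar_sum; congr (_ *: _).
by apply: eq_bigr => i _; rewrite ustarX TT.
Qed.

Lemma ustar_cesaro2 (T : E) n :
  ustar T = T -> ustar (cesaro2 T n) = cesaro2 T n.
Proof.
move=> TT; rewrite ustar_inv_nat ustar_sum; congr (_ *: _).
apply: eq_bigr => j _; rewrite ustar_sum.
by apply: eq_bigr => i _; rewrite ustarX TT.
Qed.

(** Take v as the limit of u Q_n for T = 1 - r. As u^* u = r^4, |u c| = |r^2 c| for self-adjoint c,
    and r^2 Q_n = r - r M_n with r M_n of order 1/n; so u Q_n is Cauchy although Q_n itself may
    diverge. *)
Lemma division u r : cstar r = r -> opbound 1 (1 - emb r) ->
    emb (cmul (cstar u) u) = emb r ^+ 4 ->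
  exists v, cmul v r = u /\ cmul (cstar v) v = cmul r r.
Proof.
move=> rr r1 ur.
pose T := 1 - emb r; pose M := cesaro T; pose Q := cesaro2 T.
have TT : ustar T = T by rewrite ustarB ustar1 ustar_emb rr.
have rE : 1 - T = emb r by rewrite /T opprB addrC subrK.
have MM n : ustar (M n) = M n by exact: ustar_cesaro.
have QQ n : ustar (Q n) = Q n by exact: ustar_cesaro2.
have rS : ustar (emb r) = emb r by rewrite ustar_emb rr.
have rQ n : emb r * Q n = 1 - M n by rewrite -rE cesaro2P.
have Qr n : Q n * emb r = 1 - M n.
  by rewrite -[LHS]ustarK ustarM QQ rS rQ ustarB ustar1 MM.
have Mr n : M n * emb r = emb r * M n.
  have {1}-> : M n = 1 - emb r * Q n by rewrite rQ opprB addrC subrK.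
  by rewrite mulrBl mul1r -mulrA Qr mulrBr mulr1 opprB addrC subrK.
have rMb n : opbound (2 / n.+1%:R) (emb r * M n).
  by rewrite -rE; exact: cesaro_opbound.
have rMu n : unorm (emb r * M n) <= 2 / n.+1%:R.
  apply: opbound_cut (rMb n); first by rewrite divr_ge0.
  by rewrite fstM mul0r.
have rM0 : hconv (fun n => emb r * M n) 0.
  by exists 2 => n; rewrite subr0.
pose f (c : E) : A := (emb u * c).2.
have fE c : emb (f c) = emb u * c by apply: emb_snd; rewrite fstM mul0r.
have uS : ustar (emb u) * emb u = emb r ^+ 4 by rewrite ustar_emb -embM.
have fnorm (c : E) : ustar c = c -> unorm (emb u * c) = unorm (emb r ^+ 2 * c).
  move=> cc; have gE : emb (emb r ^+ 2 * c).2 = emb r ^+ 2 * c.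
    by apply: emb_snd; rewrite expr2 !fstM !mul0r.
  rewrite -fE -gE !unorm_emb; apply: nrm_cstar_cmul_inj; apply: emb_inj.
  rewrite !embM -!ustar_emb fE gE !expr2 !ustarM cc rS -mulrA.
  by rewrite (mulrA (ustar _)) uS (exprD _ 2 2) !expr2 !mulrA.
have [|v vE] := @hconv_cauchy _ _ (fun n => f (Q n)) 4.
  move=> n m nm; rewrite -unorm_emb embB !fE -mulrBr fnorm; last first.
    by rewrite ustarB !QQ.
  have -> : emb r ^+ 2 * (Q m - Q n) = emb r * M n - emb r * M m.
    rewrite expr2 -mulrA mulrBr !rQ opprB -mulrBr; congr (_ * _).
    by rewrite addrC addrA subrK.
  rewrite (le_trans (unormD _ _))// unormN.
  have -> : 4 / n.+1%:R = 2 / n.+1%:R + 2 / n.+1%:R :> R.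
    by rewrite -mulrDl -natrD.
  by rewrite lerD// (le_trans (rMu m))// ler_wpM2l// lef_pV2 ?posrE// ler_nat.
exists v; split; apply: emb_inj; rewrite !embM.
  apply: (hconv_uniq (hconvM vE (hconv_cst (emb r)))).
  (* Here u Q_n r - u = - u M_n has norm |r^2 M_n| <= |r| 2/(n+1). *)
  exists (2 * unorm (emb r)) => n.
  rewrite fE -mulrA Qr mulrBr mulr1 addrAC subrr add0r unormN fnorm//.
  rewrite expr2 -mulrA [leRHS]mulrAC [leRHS]mulrC (le_trans (unormM _ _))//.
  by rewrite ler_wpM2l ?unorm_ge0.
rewrite -ustar_emb; apply: (hconv_uniq (hconvM (hconv_star vE) vE)).
(* The left side is Q_n r^4 Q_n = (1 - M_n) r^2 (1 - M_n), and M_n commutes with r. *)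
have -> : (fun n => ustar (emb (f (Q n))) * emb (f (Q n))) =
    fun n => (emb r - emb r * M n) * (emb r - emb r * M n).
  apply/funext => n; rewrite fE ustarM QQ mulrA -(mulrA (Q n)) uS.
  have -> : emb r ^+ 4 = emb r * emb r * (emb r * emb r).
    by rewrite -!expr2 -exprM.
  rewrite !mulrA Qr -!mulrA rQ [LHS]mulrA.
  by rewrite [(1 - _) * _]mulrBl mul1r Mr mulrBr mulr1.
have rl : hconv (fun n => emb r - emb r * M n) (emb r).
  by rewrite -[X in hconv _ X]subr0; apply: hconvB (hconv_cst _) rM0.
exact: hconvM.
Qed.

Lemma cstar_cmul_eq0 z : ustar z * z = 0 -> z.1 = 0 -> z = 0.
Proof.
move=> zz /emb_snd zE; move: zz; rewrite -zE ustar_emb -embM.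
move=> /(congr1 (@unorm R A)); rewrite unorm_emb nrm_cstar_cmul.
rewrite [unorm 0](unorm_emb 0) nrm0 => /eqP.
by rewrite sqrf_eq0 => /eqP/nrm0_eq0 ->.
Qed.

(** Since u^* r^4 u = u^* u^* u u = 0, the C*-identity gives r^2 u = 0, then r u = 0. As v r = u,
    the elements v v^* r, v^* r and r v vanish in turn, so v^* v^* v v = v^* r^2 v = 0. *)
Lemma division_square_zero u v r : cstar r = r -> cmul u u = 0 ->
  emb (cmul (cstar u) u) = emb r ^+ 4 -> cmul v r = u ->
  cmul (cstar v) v = cmul r r -> cmul v v = 0.
Proof.
move=> rr uu0 ur vru vv; apply: emb_inj; rewrite embM.
have rS : ustar (emb r) = emb r by rewrite ustar_emb rr.
have VV : ustar (emb v) * emb v = emb r * emb r by rewrite ustar_emb -!embM vv.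
have UU : ustar (emb u) * emb u = emb r * emb r * (emb r * emb r).
  by rewrite ustar_emb -embM ur -!expr2 -exprM.
have uu : emb u * emb u = 0 by rewrite -embM uu0.
have vu : emb v * emb r = emb u by rewrite -embM vru.
move: (emb r) (emb u) (emb v) rS VV UU uu vu
  (erefl : (emb r).1 = 0) (erefl : (emb v).1 = 0) (erefl : (emb u).1 = 0).
move=> {rr uu0 ur vru vv} {}r {}u {}v rS vv uu u0 vu r1 v1 u1.
have rru : r * r * u = 0.
  apply: cstar_cmul_eq0; last by rewrite !fstM u1 mulr0.
  rewrite !ustarM rS [LHS]mulrA -(mulrA (ustar u)) -(mulrA (ustar u)) -uu.
  by rewrite -!mulrA u0 !mulr0.
have ru : r * u = 0.
  apply: cstar_cmul_eq0; last by rewrite !fstM u1 mulr0.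
  by rewrite ustarM rS -mulrA (mulrA r) rru mulr0.
have a0 : v * (ustar v * r) = 0.
  apply: cstar_cmul_eq0; last by rewrite fstM v1 mul0r.
  rewrite !ustarM rS ustarK -!mulrA (mulrA (ustar v) v) vv -!mulrA.
  by rewrite (mulrA v r) vu (mulrA r u) ru mul0r.
have vr : ustar v * r = 0.
  apply: cstar_cmul_eq0; last by rewrite fstM r1 mulr0.
  by rewrite ustarM rS ustarK -mulrA a0 mulr0.
have rv : r * v = 0 by rewrite -[v]ustarK -rS -ustarM vr ustar0.
apply: cstar_cmul_eq0; last by rewrite fstM v1 mulr0.
by rewrite ustarM -mulrA (mulrA _ v v) vv -!mulrA rv !mulr0.
Qed.

(** Here p, r, q are |x|, |x|^(1/2), |x|^(1/4). Two divisions yield d = v |x|^(1/2) and e = v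
    |x|^(1/4) without the partial isometry v, which need not lie in [A]. *)
Lemma square_zero_factor_small x : cmul x x = 0 -> nrm x <= 2^-1 ->
  exists y z : A, [/\ cmul y y = 0, cmul z z = 0 & cmul (cmul y z) y = x].
Proof.
move=> xx x2.
have [|p [ps pp p1]] := opbound_sqrt _ (square_zero_opbound xx x2).
  by rewrite cstarM cstarK.
have [r [rs rr r1]] := opbound_sqrt ps p1.
have [q [qs qq q1]] := opbound_sqrt rs r1.
have r4 : emb (cmul (cstar x) x) = emb r ^+ 4.
  by rewrite -pp -rr !embM -!expr2 -exprM.
have [d [dr dd]] := division rs r1 r4.
have d0 := division_square_zero rs xx r4 dr dd.
have q4 : emb (cmul (cstar d) d) = emb q ^+ 4.
  by rewrite dd -qq !embM -!expr2 -exprM.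
have [e [eq ee]] := division qs q1 q4.
have e0 := division_square_zero qs d0 q4 eq ee.
(* [e d^* e = e q e^* e = e q^3 = d q^2 = x] *)
exists e, (cstar d); split=> //; first by rewrite -cstarM d0 cstar0.
by rewrite -eq cstarM qs -!cmulA ee qq cmulA eq.
Qed.

Lemma square_zero_factor x : cmul x x = 0 ->
  exists y z : A, [/\ cmul y y = 0, cmul z z = 0 & cmul (cmul y z) y = x].
Proof.
(* [c] is positive even for x = 0, and x/c has norm at most 1/2; the factor c is then put back into
   z. *)
move=> xx; pose c : R := 2 * nrm x + 1.
have c0 : 0 < c by rewrite ltr_wpDl// mulr_ge0// nrm_ge0.
have cC : c%:C%C != 0 by rewrite fmorph_eq0 gt_eqF.
have [||y [z [yy zz yzy]]] := @square_zero_factor_small ((c%:C%C)^-1 *: x).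
- by rewrite -cscalerAl -cscalerAr xx !scaler0.
- rewrite nrmZ -fmorphV nrm_real ger0_norm ?invr_ge0 ?(ltW c0)//.
  by rewrite ler_pdivrMl// /c; lra.
exists y, (c%:C%C *: z); split=> //.
  by rewrite -cscalerAl -cscalerAr zz !scaler0.
by rewrite -cscalerAr -cscalerAl yzy scalerA divff// scale1r.
Qed.
End Division.

(** * Linear spans *)

Section LinearSpan.
Variables (K : nzRingType) (V : lmodType K).
Implicit Types (X Y : set V) (u v : V).

Lemma linear_span_gen X v : X v -> linear_span X v.
Proof. by exists 1%N, (fun=> 1), (fun=> v); rewrite big_ord1 scale1r. Qed.

Lemma linear_spanZ X (c : K) v : linear_span X v -> linear_span X (c *: v).
Proof.
move=> [n [d [x [Xx ->]]]]; exists n, (fun i => c * d i), x; split=> //.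
by rewrite scaler_sumr; apply: eq_bigr => i _; rewrite scalerA.
Qed.

Lemma linear_spanD X u v :
  linear_span X u -> linear_span X v -> linear_span X (u + v).
Proof.
move=> [n [c [x [Xx ->]]]] [m [d [y [Xy ->]]]].
pose f T (a : 'I_n -> T) (b : 'I_m -> T) (i : 'I_(n + m)) :=
  match split i with inl j => a j | inr j => b j end.
exists (n + m)%N, (f _ c d), (f _ x y); split=> [i|].
  by rewrite /f; case: split.
rewrite big_split_ord; congr (_ + _); apply: eq_bigr => i _.
  by rewrite /f (unsplitK (inl i)).
by rewrite /f (unsplitK (inr i)).
Qed.

Lemma linear_span_ind X (P : V -> Prop) :
  P 0 -> (forall u v, P u -> P v -> P (u + v)) ->
  (forall (c : K) v, P v -> P (c *: v)) -> (forall v, X v -> P v) ->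
  forall v, linear_span X v -> P v.
Proof.
move=> P0 PD PZ PX _ [n [c [x [Xx ->]]]].
by apply: big_ind => // i _; apply/PZ/PX.
Qed.

Lemma linear_span0 X : linear_span X 0.
Proof.
by exists 0%N, (fun=> 0), (fun=> 0); rewrite big_ord0; split=> // -[].
Qed.
End LinearSpan.

(** * Commutators of square-zero elements and the two inclusions *)

Section Commutators.
Variables (R : realType) (A : cstarAlgType R).
Implicit Types (x y z : A).

Lemma emb_commutator x y : emb (commutator x y) = emb x * emb y - emb y * emb x.
Proof. by rewrite embB !embM. Qed.

Lemma commutatorDl x y z :
  commutator (x + y) z = commutator x z + commutator y z.
Proof. by rewrite /commutator cmulDl cmulDr opprD addrACA. Qed.

Lemma commutatorZl (c : R[i]) x y : commutator (c *: x) y = c *: commutator x y.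
Proof. by rewrite /commutator -cscalerAl -cscalerAr scalerBr. Qed.

Lemma commutatorN x y : commutator x y = - commutator y x.
Proof. by rewrite opprB. Qed.

(* [1 + x] is invertible with inverse [1 - x]. *)
Lemma conjugate_square_zero x y : cmul x x = 0 -> cmul y y = 0 ->
  square_zero A (y + commutator x y - cmul (cmul x y) x).
Proof.
move=> xx yy; have XX : emb x * emb x = 0 by rewrite -embM xx.
have YY : emb y * emb y = 0 by rewrite -embM yy.
have E : emb (y + commutator x y - cmul (cmul x y) x)
    = (1 + emb x) * emb y * (1 - emb x).
  rewrite embB embD emb_commutator !embM mulrDl mul1r mulrBr mulr1 mulrDl opprD.
  by rewrite !addrA; congr (_ - _); rewrite addrAC.
apply: emb_inj; rewrite embM E.
have inv : (1 - emb x) * (1 + emb x) = 1.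
  by rewrite mulrDr mulr1 mulrBl mul1r XX subr0 subrK.
rewrite !mulrA -(mulrA _ (1 - _)) inv mulr1 -(mulrA _ (emb y) (emb y)) YY.
by rewrite mulr0 mul0r.
Qed.

(** Replacing x by -x keeps y - xyx and changes the sign of [x, y], so [x, y] is half the difference
    of the two conjugates. *)
Lemma commutator_square_zero x y : cmul x x = 0 -> cmul y y = 0 ->
  linear_span (square_zero A) (commutator x y).
Proof.
move=> xx yy.
have nl z w : cmul (- z) w = - cmul z w :> A.
  by apply: emb_inj; rewrite !(embM, embN) mulNr.
have nr z w : cmul z (- w) = - cmul z w :> A.
  by apply: emb_inj; rewrite !(embM, embN) mulrN.
have nx : cmul (- x) (- x) = 0 by rewrite nl nr opprK.
have -> : commutator x y = 2^-1 *: ((y + commutator x y - cmul (cmul x y) x) +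
    (-1) *: (y + commutator (- x) y - cmul (cmul (- x) y) (- x))).
  have -> : commutator (- x) y = - commutator x y.
    by rewrite -scaleN1r commutatorZl scaleN1r.
  rewrite scaleN1r !(nl, nr) opprK; move: (commutator x y) (cmul _ x) => c s.
  have -> : y + c - s - (y - c - s) = (2 : R[i]) *: c.
    by rewrite scaler_nat mulr2n opprB addrA subrK opprB addrC addrA subrK.
  by rewrite scalerA mulVf ?scale1r// pnatr_eq0.
apply/linear_spanZ/linear_spanD.
  exact/linear_span_gen/conjugate_square_zero.
exact/linear_spanZ/linear_span_gen/conjugate_square_zero.
Qed.

(** Linearity is used in the first argument only; antisymmetry carries it to the second. *)
Lemma commutator_span_square_zero x y :
  linear_span (square_zero A) x -> linear_span (square_zero A) y ->
  linear_span (square_zero A) (commutator x y).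
Proof.
move=> Nx Ny; pose P z w := linear_span (square_zero A) (commutator z w).
have ind (w : A) : (forall z, square_zero A z -> P z w) ->
    forall z, linear_span (square_zero A) z -> P z w.
  move=> Pw; apply: linear_span_ind => [|u v Pu Pv|c u Pu|]; last exact: Pw.
  - by rewrite /P -(scale0r 0) commutatorZl scale0r; exact: linear_span0.
  - by rewrite /P commutatorDl; exact: linear_spanD.
  - by rewrite /P commutatorZl; exact: linear_spanZ.
apply: (ind y _ x Nx) => x' xx'; rewrite /P commutatorN -scaleN1r.
apply: linear_spanZ.
by apply: (ind x' _ y Ny) => y' yy'; exact: commutator_square_zero.
Qed.

(** In the expansion the terms z y^2 and y^2 z vanish. *)
Lemma double_commutator_square_zero y z : cmul y y = 0 ->
  commutator (commutator y z) y = 2 *: cmul (cmul y z) y.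
Proof.
move=> yy; have YY : emb y * emb y = 0 by rewrite -embM yy.
apply: emb_inj; rewrite emb_commutator emb_commutator embZ !embM mulrBl mulrBr.
rewrite -(mulrA _ _ (emb y)) -!mulrA YY mulr0 subr0 (mulrA (emb y) (emb y)) YY.
by rewrite mul0r sub0r opprK scaler_nat mulr2n.
Qed.
End Commutators.

Theorem theoremD (R : realType) (A : cstarAlgType R) :
  let N := linear_span (square_zero A) in
  commutator_span N N = N.
Proof.
move=> N; apply/seteqP; split=> x.
  apply: linear_span_ind => [|u v|c u|_ [y Ny [z Nz <-]]].
  - exact: linear_span0.
  - exact: linear_spanD.
  - exact: linear_spanZ.
  - exact: commutator_span_square_zero.
apply: linear_span_ind => [|u v|c u|{}x xx].
- exact: linear_span0.
- exact: linear_spanD.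
- exact: linear_spanZ.
have [y [z [yy zz <-]]] := square_zero_factor xx.
(* As [y, z] lies in N, the double commutator is a generator of [N, N]. *)
have -> : cmul (cmul y z) y = 2^-1 *: commutator (commutator y z) y.
  by rewrite double_commutator_square_zero// scalerA mulVf ?scale1r// pnatr_eq0.
apply: linear_spanZ; apply: linear_span_gen.
have Ny : N y by exact: linear_span_gen.
have Nz : N z by exact: linear_span_gen.
by exists (commutator y z); [exact: commutator_span_square_zero|exists y].
Qed.
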